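(* Let $\mathcal{A}$ be a C*-algebra with identity $1$, let $\Gamma$ be a totally ordered abelian group with identity $0$ and positive cone $\Gamma^+=\{x\in\Gamma:0\le x\}$, and let $\alpha:\Gamma^+\to\mathrm{End}(\mathcal{A})$ be a semigroup homomorphism into the $*$-endomorphisms of $\mathcal{A}$ (so $\alpha_0=\mathrm{Id}$ and $\alpha_x\circ\alpha_y=\alpha_{x+y}$ for $x,y\in\Gamma^+$). The following are equivalent: 1) there exists a complete transfer action $L$ for $(\mathcal{A},\Gamma^+,\alpha)$; 2) (i) there exists a non-degenerate transfer action $L$ for $(\mathcal{A},\Gamma^+,\alpha)$, and (ii) $\alpha_x(\mathcal{A})$ is a hereditary subalgebra of $\mathcal{A}$ for each $x\in\Gamma^+$; 3) (i) there exists a family $\{P_x\}_{x\in\Gamma^+}$ of central orthogonal projections in $\mathcal{A}$ such that (a) $\alpha_x(P_{x+y})=\alpha_x(1)P_y$ for all $x,y\in\Gamma^+$, and (b) the maps $\alpha_x:P_x\mathcal{A}\to\alpha_x(\mathcal{A})$ are $*$-isomorphisms; and (ii) $\alpha_x(\mathcal{A})=\alpha_x(1)\mathcal{A}\alpha_x(1)$ for each $x\in\Gamma^+$. Moreover, the objects in 1)–3) are uniquely determined (the transfer action $L$ in 1) and 2) is unique, and the family $\{P_x\}_{x\in\Gamma^+}$ in 3) is unique), and they are related by $P_x=L_x(1)$ for $x\in\Gamma^+$ and $$L_x(a)=\alpha_x^{-1}(\alpha_x(1)a\alpha_x(1)),\quad a\in\mathcal{A},$$ where $\alpha_x^{-1}:\alpha_x(\mathcal{A})\to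 P_x\mathcal{A}$ is the inverse of the $*$-isomorphism $\alpha_x:P_x\mathcal{A}\to\alpha_x(\mathcal{A})$.
   Context: A transfer action for $(\mathcal{A},\Gamma^+,\alpha)$ is a family $L=\{L_x\}_{x\in\Gamma^+}$ of continuous, linear, positive maps $L_x:\mathcal{A}\to\mathcal{A}$ such that $L_{x+y}=L_y\circ L_x$ for all $x,y\in\Gamma^+$ and $L_x(\alpha_x(a)b)=aL_x(b)$ for all $a,b\in\mathcal{A}$, $x\in\Gamma^+$. A transfer action is non-degenerate if for each $x\in\Gamma^+$ the composition $\alpha_x\circ L_x$ is a conditional expectation onto $\alpha_x(\mathcal{A})$ (equivalently $\alpha_x\circ L_x\circ\alpha_x=\alpha_x$, equivalently $\alpha_x(L_x(1))=\alpha_x(1)$). A transfer action is complete if $\alpha_x(L_x(a))=\alpha_x(1)a\alpha_x(1)$ for all $x\in\Gamma^+$, $a\in\mathcal{A}$. *)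

(* Defs.v *)
From HB Require Import structures.
From mathcomp Require Import all_boot all_order all_algebra.
From mathcomp Require Import all_classical all_reals all_analysis.
From mathcomp Require Import complex.
Import numFieldNormedType.Exports.
Set Implicit Arguments. Unset Strict Implicit. Unset Printing Implicit Defensive.
Import Order.TTheory GRing.Theory Num.Theory.
Local Open Scope ring_scope.

(* (A joint HB structure "ring & normed module" is rejected by HB, hence the *)
(* explicit record.)                                                         *)
Record cstarAlgebra (R : realType) (V : completeNormedModType R[i]) := CStarAlgebra {
  cmul : V -> V -> V;
  cone : V;
  cstar : V -> V;
  cmulA : forall a b c, cmul a (cmul b c) = cmul (cmul a b) c;
  cmulDl : forall a b c, cmul (a + b) c = cmul a c + cmul b c;
  cmulDr : forall a b c, cmul a (b + c) = cmul a b + cmul a c;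
  cmulZl : forall (k : R[i]) a b, cmul (k *: a) b = k *: cmul a b;
  cmulZr : forall (k : R[i]) a b, cmul a (k *: b) = k *: cmul a b;
  cmul1l : forall a, cmul cone a = a;
  cmul1r : forall a, cmul a cone = a;
  cstarD : forall a b, cstar (a + b) = cstar a + cstar b;
  cstarZ : forall (k : R[i]) a, cstar (k *: a) = Num.conj k *: cstar a;
  cstarM : forall a b, cstar (cmul a b) = cmul (cstar b) (cstar a);
  cstarK : forall a, cstar (cstar a) = a;
  cnormM : forall a b, `|cmul a b| <= `|a| * `|b|;
  cnorm_cstar : forall a, `|cmul (cstar a) a| = `|a| ^+ 2
}.

Section CStarDefs.
Variables (R : realType) (V : completeNormedModType R[i]) (A : cstarAlgebra V).
Local Notation "a ** b" := (cmul A a b) (at level 40, left associativity).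
Local Notation one := (cone A).
Local Notation star := (cstar A).

Definition cs_invertible (a : V) : Prop := exists b : V, a ** b = one /\ b ** a = one.

Definition cs_spectrum (a : V) : set R[i] := [set l | ~ cs_invertible (a - l *: one)].

Definition cs_selfadjoint (a : V) : Prop := star a = a.

Definition cs_positive (a : V) : Prop :=
  cs_selfadjoint a /\ forall l, cs_spectrum a l -> 0 <= l.

Definition cs_le (a b : V) : Prop := cs_positive (b - a).

Definition cs_projection (p : V) : Prop := p ** p = p /\ star p = p.
Definition cs_central (p : V) : Prop := forall a : V, p ** a = a ** p.

Definition cs_linear (f : V -> V) : Prop :=
  forall (c : R[i]) (a b : V), f (c *: a + b) = c *: f a + f b.

Definition cs_positive_map (f : V -> V) : Prop :=
  forall a, cs_positive a -> cs_positive (f a).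

Definition star_endomorphism (f : V -> V) : Prop :=
  [/\ cs_linear f, (forall a b, f (a ** b) = f a ** f b) &
      (forall a, f (star a) = star (f a))].

Definition cs_subalgebra (B : set V) : Prop :=
  [/\ B 0 /\ (forall a b, B a -> B b -> B (a + b)),
      (forall (c : R[i]) a, B a -> B (c *: a)),
      (forall a b, B a -> B b -> B (a ** b)),
      (forall a, B a -> B (star a)) & closed B].

Definition hereditary_subalgebra (B : set V) : Prop :=
  cs_subalgebra B /\
  (forall a b, cs_positive a -> cs_le a b -> B b -> B a).

(* conditional expectation onto B: a positive linear contractive projection *)
(* of A onto B (Tomiyama: a projection of norm one)                         *)
Definition conditional_expectation (E : V -> V) (B : set V) : Prop :=
  [/\ cs_linear E, cs_positive_map E, (forall a, `|E a| <= `|a|),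
      (forall a, B (E a)) & (forall b, B b -> E b = b)].

Definition bijective_between (f : V -> V) (S T : set V) : Prop :=
  [/\ (forall a, S a -> T (f a)),
      (forall a b, S a -> S b -> f a = f b -> a = b) &
      (forall c, T c -> exists2 a, S a & f a = c)].

End CStarDefs.

Definition total_ordered_group (G : zmodType) (le : rel G) : Prop :=
  [/\ (forall x, le x x),
      (forall x y, le x y -> le y x -> x = y),
      (forall x y z, le x y -> le y z -> le x z),
      (forall x y, le x y \/ le y x) &
      (forall x y z, le x y -> le (x + z) (y + z))].

Section Transfer.
Variables (R : realType) (V : completeNormedModType R[i]) (A : cstarAlgebra V).
Variables (G : zmodType) (le : rel G).
Local Notation "a ** b" := (cmul A a b) (at level 40, left associativity).
Local Notation one := (cone A).
Variable alpha : G -> V -> V.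

Definition endo_semigroup_action : Prop :=
  [/\ (forall x, le 0 x -> star_endomorphism A (alpha x)),
      alpha 0 = id &
      (forall x y, le 0 x -> le 0 y -> alpha x \o alpha y = alpha (x + y))].

(* transfer action for (A, Gamma^+, alpha); only the values on Gamma^+ matter *)
Definition transfer_action (L : G -> V -> V) : Prop :=
  [/\ (forall x, le 0 x ->
         [/\ cs_linear (L x), continuous (L x) & cs_positive_map A (L x)]),
      (forall x y, le 0 x -> le 0 y -> L (x + y) = L y \o L x) &
      (forall x a b, le 0 x -> L x (alpha x a ** b) = a ** L x b)].

Definition range_alpha (x : G) : set V := [set c | exists a, c = alpha x a].

Definition nondegenerate_transfer_action (L : G -> V -> V) : Prop :=
  transfer_action L /\
  forall x, le 0 x -> conditional_expectation A (alpha x \o L x) (range_alpha x).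

Definition complete_transfer_action (L : G -> V -> V) : Prop :=
  transfer_action L /\
  forall x a, le 0 x -> alpha x (L x a) = alpha x one ** a ** alpha x one.

Definition corner_left (p : V) : set V := [set c | exists a, c = p ** a].

Definition projection_family (P : G -> V) : Prop :=
  [/\ (forall x, le 0 x -> cs_projection A (P x) /\ cs_central A (P x)),
      (forall x y, le 0 x -> le 0 y -> alpha x (P (x + y)) = alpha x one ** P y) &
      (forall x, le 0 x ->
         bijective_between (alpha x) (corner_left (P x)) (range_alpha x))].

Definition range_is_corner : Prop :=
  forall x, le 0 x ->
    forall c, range_alpha x c <-> exists b, c = alpha x one ** b ** alpha x one.

End Transfer.

(* Main.v *)
Require Import Defs.
From HB Require Import structures.
From mathcomp Require Import all_boot all_order all_algebra.
From mathcomp Require Import all_classical all_reals all_analysis.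
From mathcomp Require Import complex.
From mathcomp Require Import ring lra.
Import numFieldNormedType.Exports.
Import Order.TTheory GRing.Theory Num.Theory.
Set Implicit Arguments.
Unset Strict Implicit.
Unset Printing Implicit Defensive.
Local Open Scope ring_scope.

(* A complete transfer map satisfies [alpha_x (L_x a) = e a e] with
   [e = alpha_x 1]; it is the composition of the compression to the corner [e A e]
   with the inverse of the isomorphism [P A -> e A e] induced by [alpha_x], where
   [P = L_x 1] is a central projection. All implications are algebra around this
   formula, except for three facts about positive elements: a hereditary range
   contains [e], hence all of [e A e]; conversely, corners are hereditary; and the
   inverse of [P A -> e A e] is positive and contractive.

   These facts follow from the statement that positive elements (defined by their
   spectrum) are exactly the squares of selfadjoint ones. For it one needs that a
   selfadjoint [g] with [|g| = 1] has [1] or [-1] in its spectrum, i.e. that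
   [1 - g^2] is not invertible. Square roots of [1 - x] for selfadjoint [|x| <= 1]
   are constructed by iteration. If [d^2 = 1 - g^2] is invertible and [M = |d^-1|],
   then taking [s^2 = 1 - (d^-1/M)^2] and [y = s d] gives
   [g^2 + y^2 = 1 - M^-2], and [|g|^2 <= |g^2 + y^2|] because
   [g^2 + y^2 = u^* u] with [u = g + i y]; thus [|g| < 1]. *)

(** * The norm as a real number *)

Section RealNorm.
Local Open Scope complex_scope.
Variables (R : realType) (V : completeNormedModType R[i]).
Implicit Types (a b : V) (r : R).

(** The norm of [V] takes values in [R[i]]; its real part lives in the ordered field [R], where
    linear and nonlinear arithmetic can be automated. *)
Definition nrm a : R := complex.Re `|a|.

Lemma normE a : `|a| = (nrm a)%:C.
Proof. by rewrite /nrm RRe_real // normr_real. Qed.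

Lemma nrm_ge0 a : 0 <= nrm a.
Proof. by rewrite -ler0c -normE. Qed.

Lemma nrmD a b : nrm (a + b) <= nrm a + nrm b.
Proof. by rewrite -lecR rmorphD /= -!normE ler_normD. Qed.

Lemma nrmN a : nrm (- a) = nrm a.
Proof. by rewrite /nrm normrN. Qed.

Lemma nrmBC a b : nrm (a - b) = nrm (b - a).
Proof. by rewrite /nrm distrC. Qed.

Lemma nrm0 : nrm 0 = 0 :> R.
Proof. by rewrite /nrm normr0. Qed.

Lemma nrm0_eq0 a : nrm a = 0 -> a = 0.
Proof. by move=> a0; apply/eqP; rewrite -normr_eq0 normE a0. Qed.

Lemma nrmZ (r : R) a : nrm (r%:C *: a) = `|r| * nrm a.
Proof.
apply: complexI; rewrite rmorphM /= -!normE normrZ normc_def /=.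
by rewrite expr0n /= addr0 sqrtr_sqr.
Qed.

Lemma nrm_gt0 a : a != 0 -> 0 < nrm a.
Proof.
move=> a0; rewrite lt_neqAle nrm_ge0 andbT eq_sym.
by apply: contraNneq a0 => /nrm0_eq0 ->.
Qed.

Lemma harmonic_small (C e : R) : 0 < e -> exists n : nat, C / n.+1%:R < e.
Proof.
move=> e0; exists (Num.bound (C / e)).
have [C0|C0] := ltP C 0.
  by apply: lt_trans e0; rewrite ltr_pdivrMr ?ltr0n // mul0r.
rewrite ltr_pdivrMr ?ltr0n // mulrC -ltr_pdivrMr //.
apply: lt_le_trans (archi_boundP _) _; first by rewrite divr_ge0 // ltW.
by rewrite ler_nat.
Qed.

Lemma le_harmonic_eq0 (C x : R) :
  0 <= x -> (forall n : nat, x <= C / n.+1%:R) -> x = 0.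
Proof.
move=> x0 xC; apply: le_anti; rewrite x0 andbT leNgt; apply/negP => xp.
by have [n nC] := harmonic_small C xp; have := xC n; rewrite leNgt nC.
Qed.

(** Increments add up to [w n - w (n + m)], so [w n] bounds all later deviations from [u n], and the
    harmonic bound makes [w] vanish. The explicit rate lets identities for the limit be proved by
    norm estimates. *)
Lemma telescoping_cvg (u : nat -> V) (w : nat -> R) (C : R) :
  (forall n, nrm (u n.+1 - u n) <= w n - w n.+1) ->
  (forall n, 0 <= w n <= C / n.+1%:R) ->
  exists l, forall n, nrm (u n - l) <= w n.
Proof.
move=> du wC.
have duD n m : nrm (u (n + m)%N - u n) <= w n - w (n + m)%N.
  elim: m => [|m IH]; first by rewrite addn0 !subrr nrm0.
  rewrite addnS -(subrKA (u (n + m)%N)); apply: le_trans (nrmD _ _) _.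
  by have := du (n + m)%N; lra.
have dist n m : nrm (u (n + m)%N - u n) <= w n.
  by apply: le_trans (duD n m) _; have /andP[+ _] := wC (n + m)%N; lra.
have small e : 0 < e -> exists N, w N < e.
  move=> /(harmonic_small C)[N Ne]; exists N.
  by have /andP[_ wN] := wC N; apply: le_lt_trans wN Ne.
have : cauchy (u @ \oo)%classic.
  apply/cauchyP => e e0.
  have eE : e = (complex.Re e)%:C by rewrite RRe_real // gtr0_real.
  move: e0; rewrite eE ltcR => /small[N wN].
  exists (u N); exists N => // n /= Nn.
  rewrite -ball_normE /ball_ /= normE ltcR nrmBC.
  by apply: le_lt_trans wN; have := dist N (n - N)%N; rewrite subnKC.
move=> /cauchy_cvg /cvg_ex[/= l ul].
exists l => n; rewrite leNgt; apply/negP => wl.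
(* The excess over [w n] serves as radius: a late term lies closer to [l] than that, while [dist]
   keeps it within [w n] of [u n]. *)
have d0 : 0 < (nrm (u n - l) - w n)%:C by rewrite ltcR; lra.
move/cvgrPdist_lt: ul => /(_ _ d0)[N _ HN].
have := HN (n + N)%N; rewrite /= leq_addl normE ltcR => /(_ isT).
have := nrmD (u n - u (n + N)%N) (u (n + N)%N - l); rewrite subrKA.
have := dist n N.
rewrite (nrmBC l) (nrmBC (u n)); lra.
Qed.

End RealNorm.

(** * Square roots and the spectral radius *)

Section CStar.
Local Open Scope complex_scope.
Variables (R : realType) (V : completeNormedModType R[i]) (A : cstarAlgebra V).
Local Notation "a ** b" := (cmul A a b) (at level 40, left associativity).
Local Notation one := (cone A).
Local Notation star := (cstar A).
Local Notation sa := (cs_selfadjoint A).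
Implicit Types (a b p q x y : V) (r : R).

Lemma cmul0l a : 0 ** a = 0.
Proof. by have := cmulZl A 0 0 a; rewrite !scale0r. Qed.
Lemma cmul0r a : a ** 0 = 0.
Proof. by have := cmulZr A 0 a 0; rewrite !scale0r. Qed.
Lemma cmulNl a b : (- a) ** b = - (a ** b).
Proof. by rewrite -scaleN1r cmulZl scaleN1r. Qed.
Lemma cmulNr a b : a ** (- b) = - (a ** b).
Proof. by rewrite -scaleN1r cmulZr scaleN1r. Qed.
Lemma cmulBl a b c : (a - b) ** c = a ** c - b ** c.
Proof. by rewrite cmulDl cmulNl. Qed.
Lemma cmulBr a b c : a ** (b - c) = a ** b - a ** c.
Proof. by rewrite cmulDr cmulNr. Qed.
Lemma cstar0 : star 0 = 0.
Proof. by have := cstarZ A 0 0; rewrite conjC0 !scale0r. Qed.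
Lemma cstarN a : star (- a) = - star a.
Proof. by rewrite -scaleN1r cstarZ conjCN1 scaleN1r. Qed.
Lemma cstarB a b : star (a - b) = star a - star b.
Proof. by rewrite cstarD cstarN. Qed.
Lemma cstar1 : star one = one.
Proof. by have := cstarM A (star one) one; rewrite cmul1r cstarK cmul1r. Qed.
Lemma conj_real r : Num.conj r%:C = r%:C.
Proof. by rewrite conj_Creal // complex_real. Qed.
Lemma cstarZr r a : star (r%:C *: a) = r%:C *: star a.
Proof. by rewrite cstarZ conj_real. Qed.

Lemma sa1 : sa one. Proof. exact: cstar1. Qed.
Lemma saD a b : sa a -> sa b -> sa (a + b).
Proof. by move=> ha hb; rewrite /cs_selfadjoint cstarD ha hb. Qed.
Lemma saN a : sa a -> sa (- a).
Proof. by move=> ha; rewrite /cs_selfadjoint cstarN ha. Qed.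
Lemma saB a b : sa a -> sa b -> sa (a - b).
Proof. by move=> ha hb; apply: saD => //; apply: saN. Qed.
Lemma saZ r a : sa a -> sa (r%:C *: a).
Proof. by move=> ha; rewrite /cs_selfadjoint cstarZr ha. Qed.
Lemma saM a b : sa a -> sa b -> a ** b = b ** a -> sa (a ** b).
Proof. by move=> ha hb ab; rewrite /cs_selfadjoint cstarM ha hb. Qed.
Lemma sa_sqr a : sa a -> sa (a ** a).
Proof. by move=> ha; apply: saM. Qed.
Lemma sa_conj a b : sa a -> sa (star b ** a ** b).
Proof. by move=> ha; rewrite /cs_selfadjoint !cstarM cstarK ha cmulA. Qed.

Lemma nrmM a b : nrm (a ** b) <= nrm a * nrm b.
Proof. by rewrite -lecR rmorphM /= -!normE cnormM. Qed.

Lemma nrm_star_mul a : nrm (star a ** a) = nrm a ^+ 2.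
Proof. by apply: complexI; rewrite rmorphXn /= -!normE cnorm_cstar. Qed.

Lemma nrm_sqr a : sa a -> nrm (a ** a) = nrm a ^+ 2.
Proof. by move=> ha; rewrite -nrm_star_mul ha. Qed.

(** The C*-identity and submultiplicativity give [|b|^2 <= |star b| |b|]; apply this to [a] and to
    [star a]. *)
Lemma nrm_star a : nrm (star a) = nrm a.
Proof.
suff le_star b : nrm b <= nrm (star b).
  by apply: le_anti; rewrite le_star -{2}(cstarK A a) le_star.
have := nrm_star_mul b; have := nrmM (star b) b.
have := nrm_ge0 b; have := nrm_ge0 (star b); nra.
Qed.

Lemma nrm_projection p : cs_projection A p -> nrm p <= 1.
Proof.
by move=> [pp hp]; have := nrm_sqr hp; rewrite pp; have := nrm_ge0 p; nra.
Qed.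

Lemma projection1 : cs_projection A one.
Proof. by split; rewrite ?cmul1l ?cstar1. Qed.

Lemma nrm1 : nrm one <= 1.
Proof. exact: nrm_projection projection1. Qed.

Definition ccommute a b := a ** b = b ** a.
Local Notation commute := ccommute.

Lemma commuteM a b c : commute a b -> commute a c -> commute a (b ** c).
Proof. by rewrite /ccommute => ab ac; rewrite cmulA ab -cmulA ac cmulA. Qed.
Lemma commuteD a b c : commute a b -> commute a c -> commute a (b + c).
Proof. by rewrite /ccommute cmulDl cmulDr => -> ->. Qed.
Lemma commuteN a b : commute a b -> commute a (- b).
Proof. by rewrite /ccommute cmulNl cmulNr => ->. Qed.
Lemma commuteB a b c : commute a b -> commute a c -> commute a (b - c).
Proof. by move=> ab ac; apply: commuteD => //; apply: commuteN. Qed.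
Lemma commuteZ (k : R[i]) a b : commute a b -> commute a (k *: b).
Proof. by rewrite /ccommute cmulZl cmulZr => ->. Qed.
Lemma commute1 a : commute a one.
Proof. by rewrite /ccommute cmul1l cmul1r. Qed.
Lemma commute_sym a b : commute a b -> commute b a.
Proof. by []. Qed.

Lemma halveK a : 2^-1%:C *: (a + a) = a.
Proof.
rewrite -{1 2}[a]scale1r -scalerDl scalerA -(rmorph1 (real_complex R)) -rmorphD.
by rewrite -rmorphM /= (_ : 2^-1 * (1 + 1) = 1 :> R) ?scale1r //; field.
Qed.

(* The iteration [Y <- (x + Y^2)/2] tends to [1 - sqrt (1 - x)]. It is majorised by
   the scalar iteration for [x = 1], whose distance [sqrt_gap] to its limit [1] is
   at most [2/(n+2)]; so it converges also when [|x| = 1]. *)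
Fixpoint sqrt_iter x n : V :=
  if n is m.+1 then 2^-1%:C *: (x + sqrt_iter x m ** sqrt_iter x m) else 0.

Fixpoint sqrt_gap n : R :=
  if n is m.+1 then sqrt_gap m - sqrt_gap m ^+ 2 / 2 else 1.

Lemma sqrt_gap_bound n : 0 <= sqrt_gap n <= 2 / n.+2%:R.
Proof.
elim: n => [|n /andP[g0 g1]] /=; first by apply/andP; split; lra.
have g2 : sqrt_gap n <= 1.
  by apply: le_trans g1 _; rewrite ler_pdivrMr ?ltr0n // mul1r ler_nat.
apply/andP; split; first nra.
set m : R := n.+2%:R in g1.
have m0 : 0 < m by rewrite ltr0n.
have mE : n.+3%:R = m + 1 by rewrite -natr1.
have gm : sqrt_gap n * m <= 2 by rewrite -ler_pdivlMr.
have m2 : 2 <= m by rewrite ler_nat.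
rewrite mE ler_pdivlMr; last lra.
set g := sqrt_gap n in g0 g1 g2 gm *.
(* The map [t |-> t (1 - t / 2)] increases on [[0, 1]], so [g] may be replaced by its bound [2 / m];
   what remains is [m^2 - 1 <= m^2]. *)
have : g * (1 - g / 2) <= 2 / m * (1 - 1 / m).
  have -> : 2 / m * (1 - 1 / m) = 2 / m * (1 - (2 / m) / 2) by field; lra.
  set t := 2 / m in g1 *.
  have t1 : t <= 1 by rewrite ler_pdivrMr // mul1r.
  nra.
have -> : 2 / m * (1 - 1 / m) = 2 * (m - 1) / m ^+ 2 by field; lra.
rewrite ler_pdivlMr ?exprn_gt0 //; nra.
Qed.

End CStar.

(** * Convergence of the iteration and square roots of [1 - x] *)

Section SquareRoot.
Local Open Scope complex_scope.
Variables (R : realType) (V : completeNormedModType R[i]) (A : cstarAlgebra V).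
Local Notation "a ** b" := (cmul A a b) (at level 40, left associativity).
Local Notation one := (cone A).
Local Notation star := (cstar A).
Local Notation sa := (cs_selfadjoint A).
Local Notation commute := (ccommute A).
Implicit Types (a b p q x y z : V) (r : R).

Lemma sqrt_iter_commute z x n : commute z x -> commute z (sqrt_iter A x n).
Proof.
move=> zx; elim: n => [|n IH] /=; first by rewrite /ccommute cmul0l cmul0r.
by apply: commuteZ; apply: commuteD => //; apply: commuteM.
Qed.

Lemma sqrt_iter_sa x n : sa x -> sa (sqrt_iter A x n).
Proof.
move=> hx; elim: n => [|n IH] /=; first exact: cstar0.
by apply: saZ; apply: saD => //; apply: sa_sqr.
Qed.

Lemma nrm_half a : nrm (2^-1%:C *: a) = nrm a / 2.
Proof. by rewrite nrmZ ger0_norm; [rewrite mulrC|lra]. Qed.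

Lemma sqr_subE a b : a ** a - b ** b = a ** (a - b) + (a - b) ** b.
Proof. by rewrite cmulBr cmulBl addrA subrK. Qed.

Lemma nrm_sqr_sub a b : nrm (a ** a - b ** b) <= (nrm a + nrm b) * nrm (a - b).
Proof.
rewrite sqr_subE; apply: le_trans (nrmD _ _) _.
by have := nrmM A a (a - b); have := nrmM A (a - b) b; lra.
Qed.

(** If [|Y| <= 1 - g], the next iterate has norm at most
    [(1 + (1 - g)^2) / 2 = 1 - (g - g^2 / 2)]. *)
Lemma sqrt_iter_le x n : nrm x <= 1 -> nrm (sqrt_iter A x n) <= 1 - sqrt_gap R n.
Proof.
move=> x1; elim: n => [|n IH] /=; first by rewrite nrm0 subrr.
set Y := sqrt_iter A x n in IH *; set g := sqrt_gap R n in IH *.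
rewrite nrm_half; have := nrmD x (Y ** Y); have := nrmM A Y Y.
have := nrm_ge0 Y; nra.
Qed.

Lemma sqrt_iter_step x n : nrm x <= 1 ->
  nrm (sqrt_iter A x n.+1 - sqrt_iter A x n) <= sqrt_gap R n - sqrt_gap R n.+1.
Proof.
move=> x1; elim: n => [|n IH].
  rewrite /= cmul0l addr0 subr0 nrm_half; lra.
have -> : sqrt_iter A x n.+2 - sqrt_iter A x n.+1 = 2^-1%:C *:
    (sqrt_iter A x n.+1 ** sqrt_iter A x n.+1 - sqrt_iter A x n ** sqrt_iter A x n).
  rewrite [sqrt_iter A x n.+2]/= {3}[sqrt_iter A x n.+1]/= -scalerBr.
  by rewrite opprD addrACA subrr add0r.
rewrite nrm_half.
have := sqrt_iter_le n x1; have := sqrt_iter_le n.+1 x1.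
have := nrm_sqr_sub (sqrt_iter A x n.+1) (sqrt_iter A x n).
move: IH; rewrite [sqrt_gap R n.+2]/=.
have gE : sqrt_gap R n.+1 = sqrt_gap R n - sqrt_gap R n ^+ 2 / 2 by [].
move: gE.
set Y := sqrt_iter A x n; set g := sqrt_gap R n.
set Y' := sqrt_iter A x n.+1; set g' := sqrt_gap R n.+1 => gE.
have := nrm_ge0 (Y' - Y); have := nrm_ge0 Y; have := nrm_ge0 Y'.
set d := nrm (Y' - Y); set y := nrm Y; set y' := nrm Y'.
set N := nrm _ => y'0 y0 d0 d1 N1 y'1 y1.
(* The right side is [(1 - g')^2 - (1 - g)^2], twice the corresponding step of the scalar
   iteration. *)
have : (y' + y) * d <= (2 - g - g') * (g - g').
  by apply: ler_pM => //; lra.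
nra.
Qed.

Lemma nrm_le_gap_eq0 a (C : R) : 0 <= C -> (forall n, nrm a <= C * sqrt_gap R n) -> a = 0.
Proof.
move=> C0 aC; apply: nrm0_eq0; apply: (@le_harmonic_eq0 _ (C * 2)) (nrm_ge0 _) _ => n.
apply: le_trans (aC n) _; rewrite -mulrA ler_wpM2l //.
have /andP[_ /le_trans] := sqrt_gap_bound R n; apply.
by rewrite ler_wpM2l // lef_pV2 ?posrE ?ltr0n // ler_nat.
Qed.

(** The root is [1 - l] with [l] the limit of the iteration: the fixed point equation
    [2 l = x + l^2] reads [(1 - l)^2 = 1 - x]. Each property of [l] is obtained by bounding its
    defect by a multiple of [sqrt_gap]. The commutation clause later makes products of such roots
    selfadjoint. *)
Lemma csqrt x : sa x -> nrm x <= 1 -> exists s,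
  [/\ sa s, s ** s = one - x & forall z, commute z x -> commute z s].
Proof.
move=> hx x1.
have [||l Yl] := @telescoping_cvg _ _ (sqrt_iter A x) (sqrt_gap R) 2.
- by move=> n; apply: sqrt_iter_step.
- move=> n; have /andP[-> /le_trans ->] //= := sqrt_gap_bound R n.
  by rewrite ler_wpM2l // lef_pV2 ?posrE ?ltr0n // ler_nat.
have g0 n : 0 <= sqrt_gap R n by have /andP[] := sqrt_gap_bound R n.
have g1 n : sqrt_gap R n <= 1.
  have := sqrt_iter_le n x1; have := nrm_ge0 (sqrt_iter A x n); lra.
have hl : sa l.
  apply/subr0_eq; apply: (@nrm_le_gap_eq0 _ 2) => // n.
  have -> : star l - l = (sqrt_iter A x n - l) - star (sqrt_iter A x n - l).
    by rewrite cstarB (sqrt_iter_sa n hx) opprB [RHS]addrC subrKA.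
  by have := nrmD (sqrt_iter A x n - l) (- star (sqrt_iter A x n - l));
    rewrite nrmN nrm_star; have := Yl n; lra.
have cl z : commute z x -> commute z l.
  move=> zx; apply/subr0_eq; apply: (@nrm_le_gap_eq0 _ (nrm z * 2)) => [|n].
    by rewrite mulr_ge0 ?nrm_ge0.
  have Ez := sqrt_iter_commute n zx.
  have -> : z ** l - l ** z = (sqrt_iter A x n - l) ** z - z ** (sqrt_iter A x n - l).
    by rewrite cmulBl cmulBr Ez opprB [RHS]addrC subrKA.
  have := nrmD ((sqrt_iter A x n - l) ** z) (- (z ** (sqrt_iter A x n - l))).
  rewrite nrmN; have := nrmM A (sqrt_iter A x n - l) z.
  have := nrmM A z (sqrt_iter A x n - l); have := nrm_ge0 z; have := Yl n; nra.
have fl : l + l = x + l ** l.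
  suff lE : l = 2^-1%:C *: (x + l ** l).
    by rewrite {1 2}lE -scalerDr halveK.
  apply/subr0_eq; apply: (@nrm_le_gap_eq0 _ (2 + nrm l)) => [|n].
    by have := nrm_ge0 l; lra.
  (* The defect is split through the recursion, into the error of iterate [n.+1] and the error of
     the square of iterate [n]. *)
  have -> : l - 2^-1%:C *: (x + l ** l) = - (sqrt_iter A x n.+1 - l) +
     2^-1%:C *: (sqrt_iter A x n ** sqrt_iter A x n - l ** l).
    by rewrite /= opprB !scalerDr scalerN !opprD !addrA subrK.
  have := nrmD (- (sqrt_iter A x n.+1 - l))
    (2^-1%:C *: (sqrt_iter A x n ** sqrt_iter A x n - l ** l)).
  rewrite nrmN nrm_half; have := nrm_sqr_sub (sqrt_iter A x n) l.
  have := Yl n; have := Yl n.+1; have := sqrt_iter_le n x1.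
  have := g0 n; have := g1 n.
  have gE : sqrt_gap R n.+1 = sqrt_gap R n - sqrt_gap R n ^+ 2 / 2 by [].
  have := nrm_ge0 l; have := nrm_ge0 (sqrt_iter A x n - l).
  have := nrm_ge0 (sqrt_iter A x n).
  move: gE; move: (sqrt_gap R n.+1) (sqrt_gap R n) => g' g.
  move: (nrm (sqrt_iter A x n - l)) (nrm (sqrt_iter A x n.+1 - l)) => d d'.
  move: (nrm l) (nrm (sqrt_iter A x n)) => L y gE y0 d0 L0 g1' g0' y1 d'1 d1 E E'.
  have : (y + L) * d <= (1 + L) * g by apply: ler_pM => //; lra.
  nra.
exists (one - l); split.
- exact/saB/hl/sa1.
- have -> : x = l + l - l ** l by rewrite fl addrK.
  rewrite cmulBl !cmulBr !cmul1l cmul1r !opprB !opprD !addrA.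
  by congr (_ - _); rewrite addrAC.
- by move=> z zx; apply: commuteB (commute1 _ _) (cl _ zx).
Qed.

End SquareRoot.

(** * Neumann series and the spectral radius of selfadjoint elements *)

Section SpectralNorm.
Local Open Scope complex_scope.
Variables (R : realType) (V : completeNormedModType R[i]) (A : cstarAlgebra V).
Local Notation "a ** b" := (cmul A a b) (at level 40, left associativity).
Local Notation one := (cone A).
Local Notation star := (cstar A).
Local Notation sa := (cs_selfadjoint A).
Local Notation commute := (ccommute A).
Local Notation invertible := (cs_invertible A).
Implicit Types (a b c d e g h p q x y z : V) (r k : R).

(** The partial sum [1 + x + ... + x^(n-1)] in Horner form. *)
Fixpoint neumann_sum x n : V :=
  if n is m.+1 then one + x ** neumann_sum x m else 0.

Lemma neumann_sum_commute x n : commute x (neumann_sum x n).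
Proof.
elim: n => [|n IH] /=; first by rewrite /ccommute cmul0l cmul0r.
by apply: commuteD (commute1 _ _) _; apply: commuteM.
Qed.

Lemma neumann_sum_step x n :
  nrm (neumann_sum x n.+1 - neumann_sum x n) <= nrm x ^+ n.
Proof.
elim: n => [|n IH]; first by rewrite /= cmul0r addr0 subr0 nrm1.
have -> : neumann_sum x n.+2 - neumann_sum x n.+1 =
    x ** (neumann_sum x n.+1 - neumann_sum x n).
  by rewrite [neumann_sum x n.+2]/= {2}[neumann_sum x n.+1]/=
     opprD addrACA subrr add0r -cmulBr.
apply: le_trans (nrmM _ _ _) _; rewrite exprS.
by rewrite ler_wpM2l ?nrm_ge0.
Qed.

(** Bernoulli's inequality weakens geometric decay to the harmonic rate that [telescoping_cvg]
    requires. *)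
Lemma expr_harmonic r n : 0 <= r < 1 -> r ^+ n <= (1 - r)^-1 / n.+1%:R.
Proof.
move=> /andP[r0 r1].
have bernoulli : r ^+ n * (1 + n%:R * (1 - r)) <= 1.
  elim: n => [|n IH]; first by rewrite expr0 mul0r addr0 mulr1.
  apply: le_trans IH; rewrite exprS -natr1.
  have : 0 <= r ^+ n by apply: exprn_ge0.
  have : 0 <= n%:R :> R by [].
  move: (n%:R : R) (r ^+ n) => m s m0 s0.
  rewrite (mulrC r) -mulrA ler_wpM2l //.
  have : 0 <= (m + 1) * (1 - r) ^+ 2 by rewrite mulr_ge0 ?sqr_ge0 ?addr_ge0.
  nra.
rewrite ler_pdivlMr ?ltr0n // -[leRHS]mul1r ler_pdivlMr; last lra.
apply: le_trans bernoulli; rewrite -mulrA ler_wpM2l ?exprn_ge0 //.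
rewrite -natr1; nra.
Qed.

Lemma neumann x : nrm x < 1 -> invertible (one - x).
Proof.
move=> x1; have x0 := nrm_ge0 x.
set r := nrm x in x1 x0.
(* The bound [r^n / (1 - r)] is the exact tail of the geometric series, so its differences are the
   powers of [r]. *)
have wE n : r ^+ n / (1 - r) - r ^+ n.+1 / (1 - r) = r ^+ n.
  by rewrite exprS; field; lra.
have w0 n : 0 <= r ^+ n / (1 - r) by rewrite divr_ge0 ?exprn_ge0 //; lra.
have wC n : r ^+ n / (1 - r) <= (1 - r)^-1 / (1 - r) / n.+1%:R.
  rewrite mulrAC ler_wpM2r ?invr_ge0; [by [] | lra |].
  by apply: expr_harmonic; rewrite x0.
have [||l ul] := @telescoping_cvg _ _ (neumann_sum x)
    (fun n => r ^+ n / (1 - r)) ((1 - r)^-1 / (1 - r)).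
- by move=> n; rewrite wE; apply: neumann_sum_step.
- by move=> n; rewrite w0 wC.
have lim_eq0 a : (forall n, nrm a <= 2 * (r ^+ n / (1 - r))) -> a = 0.
  move=> ar; apply: nrm0_eq0.
  apply: (@le_harmonic_eq0 _ (2 * ((1 - r)^-1 / (1 - r)))) (nrm_ge0 _) _ => n.
  by apply: le_trans (ar n) _; rewrite -mulrA ler_wpM2l.
have lE : l = one + x ** l.
  apply/subr0_eq; apply: lim_eq0 => n.
  have -> : l - (one + x ** l) = x ** (neumann_sum x n - l) - (neumann_sum x n.+1 - l).
    by rewrite /= cmulBr opprB [RHS]addrC !opprD !(addrA l) subrKA.
  have := nrmD (x ** (neumann_sum x n - l)) (- (neumann_sum x n.+1 - l)).
  rewrite nrmN; have := nrmM A x (neumann_sum x n - l).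
  have := ul n; have := ul n.+1; rewrite /= -/r.
  have : r ^+ n.+1 / (1 - r) <= r ^+ n / (1 - r).
    by rewrite -subr_ge0 wE exprn_ge0.
  have : r * nrm (neumann_sum x n - l) <= nrm (neumann_sum x n - l).
    by rewrite ler_piMl ?nrm_ge0 ?ltW.
  lra.
(* Commutation with [x] turns the fixed point equation into a two-sided inverse. *)
have lx : x ** l = l ** x.
  apply/subr0_eq; apply: lim_eq0 => n.
  have -> : x ** l - l ** x = (neumann_sum x n - l) ** x - x ** (neumann_sum x n - l).
    by rewrite cmulBl cmulBr neumann_sum_commute opprB [RHS]addrC subrKA.
  have := nrmD ((neumann_sum x n - l) ** x) (- (x ** (neumann_sum x n - l))).
  rewrite nrmN; have := nrmM A x (neumann_sum x n - l); have := nrmM A (neumann_sum x n - l) x.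
  have := ul n; rewrite /= -/r (mulrC _ r).
  have : r * nrm (neumann_sum x n - l) <= nrm (neumann_sum x n - l).
    by rewrite ler_piMl ?nrm_ge0 ?ltW.
  lra.
by exists l; rewrite cmulBl cmulBr cmul1l cmul1r -lx {1 3}lE addrK.
Qed.

Lemma invertible_lr a b c : b ** a = one -> a ** c = one -> invertible a.
Proof.
move=> ba ac; have bc : b = c by rewrite -[b](cmul1r A) -ac cmulA ba cmul1l.
by exists b; rewrite {1}bc.
Qed.

Lemma invertibleM a b : invertible a -> invertible b -> invertible (a ** b).
Proof.
move=> [a' [aa' a'a]] [b' [bb' b'b]]; exists (b' ** a'); split.
  by rewrite cmulA -(cmulA A a) bb' cmul1r.
by rewrite cmulA -(cmulA A b') a'a cmul1r.
Qed.

Lemma invertible_factor a b : commute a b -> invertible (a ** b) -> invertible a.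
Proof.
move=> ab [c [abc cab]]; apply: (@invertible_lr a (c ** b) (b ** c)).
  by rewrite -cmulA -ab.
by rewrite cmulA.
Qed.

Lemma invertibleZ (k : R[i]) a : k != 0 -> invertible a -> invertible (k *: a).
Proof.
move=> k0 [b [ab ba]]; exists (k^-1 *: b).
by rewrite !cmulZl !cmulZr !scalerA ab ba mulfV // mulVf // scale1r.
Qed.

Lemma realZA r k a : r%:C *: (k%:C *: a) = (r * k)%:C *: a.
Proof. by rewrite scalerA -rmorphM. Qed.

Lemma realZD r k a : (r + k)%:C *: a = r%:C *: a + k%:C *: a.
Proof. by rewrite rmorphD scalerDl. Qed.

Lemma realZN r a : (- r)%:C *: a = - (r%:C *: a).
Proof. by rewrite rmorphN scaleNr. Qed.

Lemma realZ1 r a : r = 1 -> r%:C *: a = a.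
Proof. by move=> ->; rewrite scale1r. Qed.

(* [p^2 + q^2 = u^* u] for the normal element [u = p + i q]. *)
Lemma nrm_sum_sqr p q : sa p -> sa q -> commute p q ->
  nrm p ^+ 2 <= nrm (p ** p + q ** q).
Proof.
move=> hp hq pq; set u := p + 'i%C *: q.
have iconj : Num.conj ('i%C : R[i]) = - 'i%C by rewrite complexiE conjCi.
have su : star u = p - 'i%C *: q by rewrite cstarD cstarZ hp hq iconj scaleNr.
have ii : ('i%C : R[i]) * 'i%C = -1 by rewrite -expr2 sqr_i.
have uu : star u ** u = p ** p + q ** q.
  rewrite su /u cmulBl !cmulDr !cmulZl !cmulZr scalerA ii scaleN1r pq.
  by rewrite opprD opprK addrA addrK.
have pp : p + p = u + star u by rewrite su /u addrACA subrr addr0.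
(* As the real part of [u], the element [p] is the mean of [u] and [star u], which have equal
   norms. *)
have : nrm p <= nrm u.
  rewrite -[p]halveK pp nrm_half; have := nrmD u (star u).
  by rewrite nrm_star; lra.
by rewrite -uu nrm_star_mul; have := nrm_ge0 p; nra.
Qed.

(** The norm bound on [s] comes from [nrm_sum_sqr], since [s^2 + g^2 = 1]. *)
Lemma complement_sqr g : sa g -> nrm g <= 1 -> exists s,
  [/\ sa s, s ** s = one - g ** g, nrm s <= 1 &
      forall z, commute z g -> commute z s].
Proof.
move=> hg g1; have [||s [hs ss cs]] := @csqrt _ _ A (g ** g).
- exact: sa_sqr.
- by rewrite nrm_sqr //; have := nrm_ge0 g; nra.
have cgs z : commute z g -> commute z s by move=> zg; apply/cs/commuteM.
exists s; split=> //.
have := @nrm_sum_sqr s g hs hg; rewrite ss subrK => /(_ (commute_sym (cgs _ erefl))).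
have := nrm1 A; have := nrm_ge0 s; nra.
Qed.

(* The spectral radius of a selfadjoint element is its norm; square roots of
   [1 - g^2] and of [1 - d^-2 / |d^-1|^2] replace the usual function theory. *)
Lemma nrm_lt1_of_invertible g : sa g -> nrm g <= 1 -> invertible (one - g ** g) ->
  nrm g < 1.
Proof.
move=> hg g1 inv; have [d [hd dd d1 cd]] := complement_sqr hg g1.
(* The zero algebra is allowed, and there the unit has norm 0; in general [|1|^2 = |1|]. *)
have [n1|n1] : nrm one = 0 \/ nrm one = 1.
  have := nrm_sqr (sa1 A); rewrite cmul1l => n1; have := nrm_ge0 one.
  have /eqP : nrm one * (nrm one - 1) = 0 by rewrite mulrBr mulr1 -expr2 -n1 subrr.
  by rewrite mulf_eq0 subr_eq0 => /orP[] /eqP; [left|right].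
- have : nrm g <= nrm g * nrm one by rewrite -{1}[g](cmul1r A) nrmM.
  by rewrite n1 mulr0; lra.
have [d' [d'r d'l]] : invertible d.
  by apply: (@invertible_factor d d erefl); rewrite dd.
have hd' : sa d'.
  rewrite /cs_selfadjoint -[star d'](cmul1r A) -d'r cmulA -{1}hd -cstarM d'r.
  by rewrite cstar1 cmul1l.
have cd' z : commute z d -> commute z d'.
  move=> zd; rewrite /ccommute -[z ** d'](cmul1l A) -d'l -!cmulA; congr (_ ** _).
  by rewrite cmulA -zd -cmulA d'r cmul1r.
set M := nrm d'.
(* Since [1 = |d d'| <= |d| M] and [|d| <= 1]. This keeps [1 - M^-2] nonnegative below. *)
have M1 : 1 <= M.
  have := nrmM A d d'; rewrite d'r n1 -/M.
  by have := nrm_ge0 d; have := nrm_ge0 d'; rewrite -/M; nra.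
have [||s [hs ss s1 cs]] := @complement_sqr (M^-1%:C *: d').
- exact: saZ.
- by rewrite nrmZ -/M ger0_norm ?invr_ge0 ?mulVf //; lra.
have csz z : commute z d -> commute z s by move=> zd; apply/cs/commuteZ/cd'.
have sd : commute s d by apply/commute_sym/csz.
have gd : commute g d by apply: cd.
have hsd : sa (s ** d) by apply: saM.
have yE : (s ** d) ** (s ** d) = d ** d - (M^-2)%:C *: one.
  have -> : (s ** d) ** (s ** d) = (s ** s) ** (d ** d).
    by rewrite -cmulA (cmulA A d) -sd -cmulA cmulA.
  rewrite ss cmulBl cmul1l !(cmulZl, cmulZr) realZA.
  rewrite -(cmulA A d') (cmulA A d' d) d'l cmul1l d'l.
  by congr (_ - _%:C *: _); rewrite -exprVn expr2.
have : nrm g ^+ 2 <= 1 - M^-2.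
  have := nrm_sum_sqr hg hsd (commuteM (csz _ gd) gd).
  rewrite yE dd addrA subrKC.
  have -> : one - (M^-2)%:C *: one = (1 - M^-2)%:C *: one.
    by rewrite realZD realZN realZ1.
  rewrite nrmZ n1 mulr1 ger0_norm // subr_ge0 invf_le1 ?exprn_gt0 //; last lra.
  by rewrite exprn_ege1.
have : 0 < M^-2 by rewrite invr_gt0 exprn_gt0 //; lra.
have := nrm_ge0 g; nra.
Qed.

End SpectralNorm.

(** * Positive elements and corners *)

Section Positivity.
Local Open Scope complex_scope.
Variables (R : realType) (V : completeNormedModType R[i]) (A : cstarAlgebra V).
Local Notation "a ** b" := (cmul A a b) (at level 40, left associativity).
Local Notation one := (cone A).
Local Notation star := (cstar A).
Local Notation sa := (cs_selfadjoint A).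
Local Notation commute := (ccommute A).
Local Notation invertible := (cs_invertible A).
Local Notation positive := (cs_positive A).
Implicit Types (a b c d e g h p q x y z : V) (r k : R).

Lemma csum_diff_mul a b : commute a b -> (a - b) ** (a + b) = a ** a - b ** b.
Proof. by move=> ab; rewrite cmulBl !cmulDr ab opprD addrA addrK. Qed.

(** For [g = h / |h|] the element [1 - g^2] is a multiple of [(h - |h|) (h + |h|)]; were both
    factors invertible, [|g| < 1] would follow. *)
Lemma norm_in_spectrum h : sa h -> h != 0 ->
  invertible (h - (nrm h)%:C *: one) -> invertible (h + (nrm h)%:C *: one) -> False.
Proof.
move=> hh h0; set n := nrm h => inv1 inv2.
have n0 : 0 < n by exact: nrm_gt0.
have ng : nrm (n^-1%:C *: h) = 1.
  by rewrite nrmZ -/n ger0_norm ?invr_ge0 ?mulVf ?gt_eqF // ltW.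
suff : nrm (n^-1%:C *: h) < 1 by rewrite ng ltxx.
apply: (@nrm_lt1_of_invertible _ _ A); rewrite ?ng //; first exact: saZ.
have -> : one - n^-1%:C *: h ** (n^-1%:C *: h) =
    (- n^-2)%:C *: ((h - n%:C *: one) ** (h + n%:C *: one)).
  rewrite csum_diff_mul; last exact/commuteZ/commute1.
  rewrite !cmulZl !cmulZr cmul1l !realZA realZN scalerBr opprB realZA.
  rewrite [X in _ = X - _]realZ1; last by field; lra.
  by congr (_ - _%:C *: _); field; lra.
apply: invertibleZ; last exact: invertibleM.
by rewrite rmorphN oppr_eq0 fmorph_eq0 invr_eq0 expf_eq0 /= gt_eqF.
Qed.

Lemma positive_invertible a r : positive a -> 0 < r -> invertible (a + r%:C *: one).
Proof.
move=> [_ pa] r0; apply: contrapT => ninv.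
have := pa (- r)%:C; rewrite /cs_spectrum /= realZN opprK => /(_ ninv).
by rewrite ler0c; lra.
Qed.

(** Positivity of [a] and of [- a] excludes both [-|a|] and [|a|] from the spectrum of [a]. *)
Lemma positive_antisym a : positive a -> positive (- a) -> a = 0.
Proof.
move=> pa pna; apply: contrapT => /eqP a0.
have n0 : 0 < nrm a by exact: nrm_gt0.
apply: (norm_in_spectrum pa.1 a0); last exact: positive_invertible.
have := positive_invertible pna n0.
move/(@invertibleZ _ _ A (-1)) => /(_ _); rewrite scaleN1r opprD opprK; apply.
by rewrite oppr_eq0 oner_eq0.
Qed.

(** Suppose [h = |a| - a] had norm above [|a|]. Then [h - |h|] is minus [a] plus a positive scalar,
    hence invertible, and [h + |h|] is invertible by a Neumann series, so neither sign of [|h|] is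
    in the spectrum. *)
Lemma positive_nrm a : positive a -> nrm ((nrm a)%:C *: one - a) <= nrm a.
Proof.
move=> pa; set n := nrm a; set h := _ - a; rewrite leNgt; apply/negP => nh.
have n0 : 0 <= n := nrm_ge0 a.
have hh : sa h by apply: saB pa.1; apply/saZ/sa1.
have h0 : h != 0 by apply: contraTneq nh => ->; rewrite nrm0 -leNgt.
apply: (norm_in_spectrum hh h0).
  have -> : h - (nrm h)%:C *: one = (-1) *: (a + (nrm h - n)%:C *: one).
    by rewrite scaleN1r realZD realZN opprD opprB /h addrAC [RHS]addrC.
  apply: invertibleZ; first by rewrite oppr_eq0 oner_eq0.
  by apply: positive_invertible => //; lra.
have -> : h + (nrm h)%:C *: one =
    (n + nrm h)%:C *: (one - (n + nrm h)^-1%:C *: a).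
  rewrite scalerBr realZA [X in _ - X]realZ1; last by field; lra.
  by rewrite realZD addrAC.
apply: invertibleZ; first by rewrite fmorph_eq0 gt_eqF //; lra.
apply: neumann; rewrite nrmZ ger0_norm ?invr_ge0 -/n; last lra.
by rewrite mulrC ltr_pdivrMr; lra.
Qed.

(** With [n = |a|], [csqrt] applies to [1 - a / n] by [positive_nrm] and yields a root of
    [a / n]. *)
Lemma positive_sqrt a : positive a -> exists2 s, sa s & a = s ** s.
Proof.
move=> pa; have [->|a0] := eqVneq a 0.
  by exists 0; [exact: cstar0|rewrite cmul0l].
have n0 : 0 < nrm a by exact: nrm_gt0.
set n := nrm a in n0.
have [||s [hs ss _]] := @csqrt _ _ A (n^-1%:C *: (n%:C *: one - a)).
- by apply/saZ/saB; [apply/saZ/sa1|exact: pa.1].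
- rewrite nrmZ ger0_norm ?invr_ge0 ?(ltW n0) // mulrC ler_pdivrMr // mul1r.
  exact: positive_nrm.
exists ((Num.sqrt n)%:C *: s); first exact: saZ.
rewrite cmulZl cmulZr realZA -expr2 sqr_sqrtr ?ltW // ss scalerBr realZA.
by rewrite [_ *: (_ - a)]realZ1 ?subKr // mulfV ?gt_eqF.
Qed.

Lemma nrm_sub_sqr h : sa h -> nrm ((nrm h ^+ 2)%:C *: one - h ** h) <= nrm h ^+ 2.
Proof.
move=> hh; have := nrm_ge0 h; rewrite le_eqVlt => /predU1P[n0|n0].
  by rewrite -n0 (nrm0_eq0 (esym n0)) cmul0l subr0 expr0n /= scale0r nrm0.
set n := nrm h in n0 *.
have [||s [hs ss s1 _]] := @complement_sqr _ _ A (n^-1%:C *: h).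
- exact: saZ.
- by rewrite nrmZ ger0_norm ?invr_ge0 ?(ltW n0) // -/n mulVf ?gt_eqF.
have -> : (n ^+ 2)%:C *: one - h ** h = (n ^+ 2)%:C *: (s ** s).
  rewrite ss cmulZl cmulZr realZA scalerBr realZA [X in _ = _ - X]realZ1 //.
  by field; lra.
rewrite nrmZ nrm_sqr // ger0_norm ?sqr_ge0 //.
by rewrite ler_piMr ?sqr_ge0 // exprn_ile1 ?nrm_ge0.
Qed.

(** With [C = r^2 + |h|^2] the element is [C (1 - (|h|^2 - h^2) / C)], and [nrm_sub_sqr] makes the
    subtracted term smaller than 1 in norm. *)
Lemma invertible_sqr_add h r : sa h -> r != 0 ->
  invertible (h ** h + (r ^+ 2)%:C *: one).
Proof.
move=> hh r0; set n := nrm h; set C := r ^+ 2 + n ^+ 2.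
have r20 : 0 < r ^+ 2 by rewrite lt_neqAle sqr_ge0 andbT eq_sym expf_eq0.
have C0 : 0 < C by apply: ltr_pwDl; rewrite ?sqr_ge0.
have -> : h ** h + (r ^+ 2)%:C *: one =
    C%:C *: (one - C^-1%:C *: ((n ^+ 2)%:C *: one - h ** h)).
  rewrite scalerBr realZA [X in _ = _ - X]realZ1 ?mulfV ?gt_eqF //.
  by rewrite /C realZD opprB addrACA subrr addr0 addrC.
apply: invertibleZ; first by rewrite fmorph_eq0 gt_eqF.
apply: neumann; rewrite nrmZ ger0_norm ?invr_ge0 ?(ltW C0) // mulrC ltr_pdivrMr // mul1r.
by apply: le_lt_trans (nrm_sub_sqr hh) _; rewrite /C -/n; lra.
Qed.

(** Writing [k = h - Re l] and [t = Im l], the element [k - i t] is a commuting factor of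
    [k^2 + t^2]. *)
Lemma invertible_nonreal h (l : R[i]) : sa h -> complex.Im l != 0 ->
  invertible (h - l *: one).
Proof.
move=> hh l0; set k := h - (complex.Re l)%:C *: one.
have hk : sa k by apply: saB => //; apply/saZ/sa1.
have lE : h - l *: one = k - ('i%C * (complex.Im l)%:C) *: one.
  by rewrite {1}(complexE l) scalerDl opprD addrA.
rewrite lE; apply: (@invertible_factor _ _ A _ (k + ('i%C * (complex.Im l)%:C) *: one)).
  apply: commute_sym; apply: commuteB; last exact/commuteZ/commute1.
  apply: commute_sym; apply: commuteD => //; exact/commuteZ/commute1.
rewrite csum_diff_mul; last exact/commuteZ/commute1.
rewrite cmulZl cmul1l scalerA mulrACA -expr2 sqr_i mulN1r scaleNr opprK.
by rewrite -rmorphM /= -expr2; apply: invertible_sqr_add.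
Qed.

(** If [l] is not a nonnegative real, its complex square root [v] is not real, and
    [g^2 - l = (g - v) (g + v)] has invertible factors. *)
Lemma sqr_positive g : sa g -> positive (g ** g).
Proof.
move=> hg; split; first exact: sa_sqr.
move=> l; apply: contraPT => l0; rewrite /cs_spectrum /=; apply.
set v := sqrtc l; have vE : v ^+ 2 = l := sqr_sqrtc l.
have v0 : complex.Im v != 0.
  apply: contra l0 => /eqP v0; rewrite -vE.
  have -> : v = (complex.Re v)%:C by rewrite [LHS]complexE v0 rmorph0 mulr0 addr0.
  by rewrite -rmorphXn ler0c sqr_ge0.
have -> : g ** g - l *: one = (g - v *: one) ** (g + v *: one).
  by rewrite csum_diff_mul; [rewrite cmulZl cmul1l scalerA -expr2 vE
                            |exact/commuteZ/commute1].
apply: invertibleM; first exact: invertible_nonreal.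
rewrite -[v]opprK scaleNr; apply: invertible_nonreal => //.
by rewrite raddfN oppr_eq0.
Qed.

Lemma positiveP a : positive a <-> exists2 s, sa s & a = s ** s.
Proof. by split=> [/positive_sqrt//|[s hs ->]]; apply: sqr_positive. Qed.

Lemma positive1 : positive one.
Proof. by rewrite -(cmul1l A one); apply/sqr_positive/sa1. Qed.

Lemma positive_oneB a : sa a -> nrm a <= 1 -> positive (one - a).
Proof.
by move=> ha a1; have [s [hs <- _]] := csqrt ha a1; apply: sqr_positive.
Qed.

Lemma positiveZ r a : 0 <= r -> positive a -> positive (r%:C *: a).
Proof.
move=> r0 /positiveP[s hs ->]; apply/positiveP.
exists ((Num.sqrt r)%:C *: s); first exact: saZ.
by rewrite cmulZl cmulZr realZA -expr2 sqr_sqrtr.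
Qed.

Lemma projectionC e : cs_projection A e -> cs_projection A (one - e).
Proof.
move=> [ee he]; split; last by rewrite cstarB cstar1 he.
by rewrite cmulBl !cmulBr !cmul1l cmul1r ee subrr subr0.
Qed.

Lemma nrm_compress e a : cs_projection A e -> nrm (e ** a ** e) <= nrm a.
Proof.
move=> /nrm_projection e1; have := nrmM A (e ** a) e; have := nrmM A e a.
have := nrm_ge0 (e ** a); have := nrm_ge0 a; have := nrm_ge0 e.
have := e1; move: (nrm e) (nrm a) (nrm (e ** a)) (nrm (e ** a ** e)) => u v w t.
nra.
Qed.

Lemma sa_compress e a : cs_projection A e -> sa a -> sa (e ** a ** e).
Proof. by move=> [_ he] ha; have := sa_conj e ha; rewrite he. Qed.

(** The root of [1 - e a e] is cut down by [e], so that it lies in the corner, where the inverse of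
    an endomorphism can act on it. *)
Lemma compress_contraction e a : cs_projection A e -> sa a -> nrm a <= 1 ->
  exists y, [/\ sa y, e ** y = y, y ** e = y, y ** y = e - e ** a ** e &
                forall z, commute z e -> commute z (e ** a ** e) -> commute z y].
Proof.
move=> pe ha a1; have [ee he] := pe.
have [||r [hr rr cr]] := @csqrt _ _ A (e ** a ** e).
- exact: sa_compress.
- exact: le_trans (nrm_compress _ pe) a1.
have er : commute e r.
  by apply: cr; rewrite /ccommute -!cmulA ee !cmulA ee.
exists (e ** r); split.
- exact: saM.
- by rewrite cmulA ee.
- by rewrite -cmulA -er cmulA ee.
- rewrite -cmulA (cmulA A r) -er -cmulA cmulA ee rr cmulBr cmul1r.
  by rewrite !cmulA ee.
- by move=> z ze zw; apply: commuteM => //; apply: cr.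
Qed.

Lemma compress_sqrt e a : cs_projection A e -> positive a ->
  exists y, [/\ sa y, e ** y = y, y ** e = y & e ** a ** e = y ** y].
Proof.
move=> pe pa; have [ee he] := pe; have := nrm_ge0 a.
rewrite le_eqVlt => /predU1P[/esym/nrm0_eq0 ->|n0].
  by exists 0; rewrite !(cmul0r, cmul0l); split=> //; exact: cstar0.
(* For [1 - a / n] in place of [a], the root obtained squares to [e a e / n]. *)
set n := nrm a in n0; have [||y [hy ey ye yE _]] :=
  @compress_contraction e (n^-1%:C *: (n%:C *: one - a)) pe.
- by apply/saZ/saB; [apply/saZ/sa1|exact: pa.1].
- rewrite nrmZ ger0_norm ?invr_ge0 ?(ltW n0) // mulrC ler_pdivrMr // mul1r.
  exact: positive_nrm.
exists ((Num.sqrt n)%:C *: y); split; first exact: saZ.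
- by rewrite cmulZr ey.
- by rewrite cmulZl ye.
have nn : n%:C *: (n^-1%:C *: (n%:C *: one - a)) = n%:C *: one - a.
  by rewrite realZA realZ1 // mulfV // gt_eqF.
rewrite cmulZl cmulZr realZA -expr2 sqr_sqrtr ?ltW //.
rewrite yE scalerBr -[X in _ = _ - X]cmulZl -cmulZr nn cmulBr cmulBl cmulZr cmul1r.
by rewrite cmulZl ee subKr.
Qed.

Lemma positive_compress e a : cs_projection A e -> positive a -> positive (e ** a ** e).
Proof.
by move=> pe /(compress_sqrt pe)[y [hy _ _ ->]]; apply: sqr_positive.
Qed.

Lemma positive_nrmB a : sa a -> positive ((nrm a)%:C *: one - a).
Proof.
move=> ha; have := nrm_ge0 a; rewrite le_eqVlt => /predU1P[n0|n0].
  rewrite -n0 (nrm0_eq0 (esym n0)) scale0r subr0; apply/positiveP.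
  by exists 0; [exact: cstar0|rewrite cmul0l].
have -> : (nrm a)%:C *: one - a = (nrm a)%:C *: (one - (nrm a)^-1%:C *: a).
  by rewrite scalerBr realZA [X in _ = _ - X]realZ1 // mulfV // gt_eqF.
apply: positiveZ; first exact: ltW.
apply: positive_oneB; first exact: saZ.
by rewrite nrmZ ger0_norm ?invr_ge0 ?(ltW n0) // mulVf // gt_eqF.
Qed.

Lemma cartesian a : exists h k : V, [/\ sa h, sa k & a = h + 'i%C *: k].
Proof.
have iconjN : Num.conj (- 'i%C : R[i]) = 'i%C by rewrite complexiE -conjCi conjCK.
exists (2^-1%:C *: (a + star a)), (2^-1%:C *: (- 'i%C *: (a - star a))); split.
- by apply: saZ; rewrite /cs_selfadjoint cstarD cstarK addrC.
- by apply: saZ; rewrite /cs_selfadjoint cstarZ cstarB cstarK iconjN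
    scaleNr -scalerN opprB.
rewrite !scalerA mulrAC mulrN -expr2 sqr_i opprK mul1r -scalerDr.
by rewrite addrACA subrr addr0 halveK.
Qed.

(** Compressing [a <= b] by [f = 1 - e] kills [b], so [f a f] and its negative are positive and
    [f a f = 0]. With [a = s^2] this says [|s f|^2 = 0], hence [a f = 0]. *)
Lemma hereditary_corner e a b : cs_projection A e -> positive a -> cs_le A a b ->
  e ** b ** e = b -> e ** a ** e = a.
Proof.
move=> pe pa ab eb; have [ee he] := pe; have pf := projectionC pe.
set f := one - e in pf.
have fe : e ** f = 0 by rewrite cmulBr cmul1r ee subrr.
have faf : f ** a ** f = 0.
  apply: positive_antisym; first exact: positive_compress.
  have := positive_compress pf ab; rewrite cmulBr cmulBl.
  by rewrite -eb -!cmulA fe !cmul0r add0r.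
have [s hs aE] := positive_sqrt pa.
have sf : s ** f = 0.
  apply: nrm0_eq0; apply/eqP; rewrite -sqrf_eq0 -(nrm_star_mul A) cstarM pf.2 hs.
  by rewrite cmulA -(cmulA A f) -aE faf nrm0.
have ae : a ** e = a.
  have : a ** f = 0 by rewrite aE -cmulA sf cmul0r.
  by rewrite cmulBr cmul1r => /subr0_eq.
have ea : e ** a = a by rewrite -{1}pa.1 -{1}he -cstarM ae pa.1.
by rewrite ea ae.
Qed.

End Positivity.

(** * A single endomorphism and its transfer map *)

Section SingleEndomorphism.
Local Open Scope complex_scope.
Variables (R : realType) (V : completeNormedModType R[i]) (A : cstarAlgebra V).
Local Notation "a ** b" := (cmul A a b) (at level 40, left associativity).
Local Notation one := (cone A).
Local Notation star := (cstar A).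
Local Notation sa := (cs_selfadjoint A).
Local Notation commute := (ccommute A).
Local Notation positive := (cs_positive A).
Implicit Types (a b c d e g h p q x y z : V) (r k : R).

Section Linear.
Variable f : V -> V.
Hypothesis f_lin : cs_linear f.

Lemma cs_linear0 : f 0 = 0.
Proof. by have := f_lin (-1) 0 0; rewrite scaler0 addr0 scaleN1r addNr. Qed.
Lemma cs_linearD a b : f (a + b) = f a + f b.
Proof. by rewrite -[a]scale1r f_lin !scale1r. Qed.
Lemma cs_linearZ (k : R[i]) a : f (k *: a) = k *: f a.
Proof. by rewrite -[k *: a]addr0 f_lin cs_linear0 addr0. Qed.
Lemma cs_linearN a : f (- a) = - f a.
Proof. by rewrite -scaleN1r cs_linearZ scaleN1r. Qed.
Lemma cs_linearB a b : f (a - b) = f a - f b.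
Proof. by rewrite cs_linearD cs_linearN. Qed.

Lemma contraction_continuous : (forall a, nrm (f a) <= nrm a) -> continuous f.
Proof.
move=> f1 a; apply/cvgrPdist_lt => eps eps0; near=> b.
rewrite -cs_linearB normE; apply: (@le_lt_trans _ _ `|a - b|).
  by rewrite normE lecR f1.
near: b; exact: (@cvgr_dist_lt _ _ _ (nbhs a) _ id a cvg_id).
Unshelve. all: by end_near. Qed.

(** A selfadjoint [a] is the difference of the positive elements [|a|] and [|a| - a], so its image
    is selfadjoint; the Cartesian decomposition gives the general case. *)
Lemma positive_map_star : cs_positive_map A f -> forall a, f (star a) = star (f a).
Proof.
move=> fpos.
have fsa a : sa a -> sa (f a).
  move=> ha; rewrite -[a](subKr ((nrm a)%:C *: one)) cs_linearB.
  apply: saB; last by case: (fpos _ (positive_nrmB ha)).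
  by rewrite cs_linearZ; apply: saZ; case: (fpos _ (positive1 A)).
move=> a; have [h [k [hh hk ->]]] := cartesian A a.
by rewrite cstarD cstarZ hh hk !cs_linearD !cs_linearZ cstarD cstarZ !fsa.
Qed.

End Linear.

Section Endomorphism.
Variable f : V -> V.
Hypothesis f_endo : star_endomorphism A f.
Local Notation e := (f one).

Lemma endo_linear : cs_linear f. Proof. by case: f_endo. Qed.
Lemma endoM a b : f (a ** b) = f a ** f b. Proof. by case: f_endo. Qed.
Lemma endo_star a : f (star a) = star (f a). Proof. by case: f_endo. Qed.

Lemma endo_sa a : sa a -> sa (f a).
Proof. by move=> ha; rewrite /cs_selfadjoint -endo_star ha. Qed.
Lemma endo_projection : cs_projection A e.
Proof. by split; [rewrite -endoM cmul1l|exact/endo_sa/sa1]. Qed.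
Lemma endo1l a : e ** f a = f a.
Proof. by rewrite -endoM cmul1l. Qed.
Lemma endo1r a : f a ** e = f a.
Proof. by rewrite -endoM cmul1r. Qed.
Lemma endo_positive : cs_positive_map A f.
Proof.
move=> a /positiveP[s hs ->]; apply/positiveP; exists (f s); last exact: endoM.
exact: endo_sa.
Qed.

(** * Transfer maps for one endomorphism *)

Section TransferMap.
Variable T : V -> V.
Hypotheses (T_lin : cs_linear T) (T_pos : cs_positive_map A T).
Hypothesis T_transfer : forall a b, T (f a ** b) = a ** T b.

(** The right-handed transfer identity is the adjoint of the left-handed one, as [T] preserves
    adjoints. *)
Lemma transferr a b : T (b ** f a) = T b ** a.
Proof.
rewrite -[LHS](cstarK A) -(positive_map_star T_lin T_pos) cstarM -endo_star T_transfer.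
by rewrite cstarM (positive_map_star T_lin T_pos) !cstarK.
Qed.

Lemma transfer_compress a : T (e ** a ** e) = T a.
Proof. by rewrite transferr T_transfer cmul1l cmul1r. Qed.

Lemma transfer_endo a : T (f a) = a ** T one.
Proof. by rewrite -[f a](cmul1r A) T_transfer. Qed.

(** Both products are [T (f a)], computed with the left and the right transfer identity. *)
Lemma transfer1_central : cs_central A (T one).
Proof. by move=> a; rewrite -transfer_endo -transferr cmul1l. Qed.

(** For selfadjoint [a], heredity puts [e (|a| - a) e], hence [e a e], into the range. There [f T]
    is the identity, and [T (e a e) = T a]. Linearity extends this to all [a]. *)
Lemma hereditary_range_complete :
  (forall b, (exists a, b = f a) -> f (T b) = b) ->
  hereditary_subalgebra A [set c | exists a, c = f a]%classic ->
  forall a, f (T a) = e ** a ** e.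
Proof.
move=> fT [_ her].
have fsa a : sa a -> f (T a) = e ** a ** e.
  move=> ha; set n := (nrm a)%:C.
  have [c cE] : exists c, e ** (n *: one - a) ** e = f c.
    (* The upper bound is [2 |a| e]; subtracting [e (|a| - a) e] from it leaves [e (|a| + a) e]. *)
    apply: (her _ (f ((n + n) *: one))); last by exists ((n + n) *: one).
      exact/positive_compress/positive_nrmB/ha/endo_projection.
    rewrite /cs_le; have -> : f ((n + n) *: one) - e ** (n *: one - a) ** e =
        e ** (n *: one - - a) ** e.
      rewrite (cs_linearZ endo_linear) !cmulBr !cmulBl !cmulZr !cmulZl.
      rewrite cmul1r (endo_projection.1) cmulNr cmulNl opprK scalerDl opprB.
      by rewrite addrACA subrr addr0.
    apply/positive_compress; first exact: endo_projection.
    by rewrite /n -nrmN; apply/positive_nrmB/saN.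
  rewrite -transfer_compress fT //; exists (n *: one - c).
  rewrite (cs_linearB endo_linear) -cE (cs_linearZ endo_linear) cmulBr cmulBl.
  by rewrite cmulZr cmulZl cmul1r (endo_projection.1) subKr.
move=> a; have [h [k [hh hk ->]]] := cartesian A a.
rewrite (cs_linearD T_lin) (cs_linearD endo_linear) (cs_linearZ T_lin).
by rewrite (cs_linearZ endo_linear) !fsa // cmulDr cmulDl cmulZr cmulZl.
Qed.

Section Complete.
Hypothesis T_complete : forall a, f (T a) = e ** a ** e.

Lemma complete_endo_transfer1 : f (T one) = e.
Proof. by rewrite T_complete cmul1r (endo_projection.1). Qed.

Lemma complete_projection : cs_projection A (T one).
Proof.
split; last by case: (T_pos (positive1 A)).
by rewrite -transfer_endo complete_endo_transfer1 -[e](cmul1r A) T_transfer cmul1l.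
Qed.

Lemma complete_range c : (exists a, c = f a) <-> (exists b, c = e ** b ** e).
Proof.
split=> [[a ->]|[b ->]]; last by exists (T b).
by exists (f a); rewrite endo1l endo1r.
Qed.

Lemma complete_corner a : T one ** T a = T a.
Proof. by rewrite -T_transfer complete_endo_transfer1 T_transfer cmul1l. Qed.

(** On the corner cut by [T 1] the map [T] is a left inverse of [f], and [f (T 1 a) = e f a = f a]
    gives surjectivity. *)
Lemma complete_bijective :
  bijective_between f (corner_left A (T one)) [set c | exists a, c = f a]%classic.
Proof.
split.
- by move=> a _; exists a.
- have fK a : corner_left A (T one) a -> T (f a) = a.
    move=> [b ->]; rewrite transfer_endo -transfer1_central cmulA.
    by rewrite complete_projection.1.
  by move=> a b /fK {2}<- /fK {2}<- ->.
- move=> _ [a ->]; exists (T one ** a); first by exists a.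
  by rewrite endoM complete_endo_transfer1 endo1l.
Qed.

Lemma complete_expectation :
  conditional_expectation A (f \o T) [set c | exists a, c = f a]%classic.
Proof.
split.
- by move=> k a b /=; rewrite T_lin endo_linear.
- by move=> a pa; apply/endo_positive/T_pos.
- move=> a; rewrite !normE lecR /= T_complete.
  exact: nrm_compress endo_projection.
- by move=> a; exists (T a).
- by move=> _ [a ->] /=; rewrite T_complete endo1l endo1r.
Qed.

Lemma closed_corner : closed [set c | exists a, c = f a]%classic.
Proof.
have pe := endo_projection.
move=> c clc; apply/complete_range; exists c; apply/esym/subr0_eq/nrm0_eq0.
apply: contrapT => /eqP n0.
(* Half the defect [|e c e - c|] is the right radius: the defect is unchanged when [f a] is
   subtracted from [c], so it is at most [2 |c - f a|]. *)
have d0 : 0 < nrm (e ** c ** e - c) / 2.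
  by rewrite divr_gt0 // lt_neqAle eq_sym n0 nrm_ge0.
have [|b [[a ->]]] := clc (ball c (nrm (e ** c ** e - c) / 2)%:C).
  by apply: nbhsx_ballx; rewrite ltcR.
rewrite -ball_normE /ball_ /= normE ltcR.
have := nrm_compress (c - f a) pe.
have := nrmD (e ** (c - f a) ** e) (- (c - f a)).
have -> : e ** (c - f a) ** e - (c - f a) = e ** c ** e - c.
  by rewrite cmulBr cmulBl endo1l endo1r opprB [f a - c]addrC addrA addrAC subrK.
rewrite nrmN; lra.
Qed.

Lemma complete_hereditary : hereditary_subalgebra A [set c | exists a, c = f a]%classic.
Proof.
split; first split.
- split; first by exists 0; rewrite (cs_linear0 endo_linear).
  by move=> _ _ [a ->] [b ->]; exists (a + b); rewrite (cs_linearD endo_linear).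
- by move=> k _ [a ->]; exists (k *: a); rewrite (cs_linearZ endo_linear).
- by move=> _ _ [a ->] [b ->]; exists (a ** b); rewrite endoM.
- by move=> _ [a ->]; exists (star a); rewrite endo_star.
- exact: closed_corner.
move=> a b pa ab [b' bE]; apply/complete_range; exists a; apply/esym.
by apply: hereditary_corner endo_projection pa ab _; rewrite bE endo1l endo1r.
Qed.

End Complete.
End TransferMap.

(** Apply [T1] to [f (T1 a) = f (T2 a)]: the left side gives [T1 a], the right side [T1 1 T2 a = T2
    (f (T1 1) a) = T2 (e a) = T2 a]. *)
Lemma complete_unique (T1 T2 : V -> V) :
  cs_linear T1 -> cs_positive_map A T1 -> (forall a b, T1 (f a ** b) = a ** T1 b) ->
  (forall a b, T2 (f a ** b) = a ** T2 b) ->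
  (forall a, f (T1 a) = e ** a ** e) -> (forall a, f (T2 a) = e ** a ** e) -> T1 = T2.
Proof.
move=> l1 p1 t1 t2 c1 c2; apply/funext => a.
have central := transfer1_central l1 p1 t1.
have T1E : T1 a = T1 (f (T1 a)).
  by rewrite (transfer_endo t1) -central (complete_corner t1 c1).
rewrite T1E c1 -c2 (transfer_endo t1) -central -t2 (complete_endo_transfer1 c1).
by rewrite t2 cmul1l.
Qed.

(** * The transfer map defined by inverting the endomorphism on a central corner *)

Section InverseTransfer.
Variables (P : V) (T : V -> V).
Hypotheses (P_proj : cs_projection A P) (P_central : cs_central A P).
Hypothesis f_inj : forall a b, P ** a = a -> P ** b = b -> f a = f b -> a = b.
Hypothesis fP : f P = e.
Hypothesis TE : forall a, P ** T a = T a /\ f (T a) = e ** a ** e.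

Let pe := endo_projection.
Let PT a : P ** T a = T a := (TE a).1.
Let fT a : f (T a) = e ** a ** e := (TE a).2.

(** Identities for [T] are verified after applying [f], which is injective on the corner of [P]. *)
Lemma inverse_transfer_eq a c : P ** c = c -> f c = e ** a ** e -> T a = c.
Proof. by move=> Pc fc; apply: f_inj => //; rewrite fT. Qed.

Lemma inverse_transfer_linear : cs_linear T.
Proof.
move=> k a b; apply: inverse_transfer_eq; first by rewrite cmulDr cmulZr !PT.
by rewrite endo_linear !fT cmulDr cmulDl cmulZr cmulZl.
Qed.

Lemma inverse_transfer_star a : T (star a) = star (T a).
Proof.
apply: inverse_transfer_eq.
  by rewrite P_central -{2}PT cstarM P_proj.2.
by rewrite endo_star fT !cstarM pe.2 cmulA.
Qed.

Lemma inverse_transfer_sa a : sa a -> sa (T a).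
Proof. by move=> ha; rewrite /cs_selfadjoint -inverse_transfer_star ha. Qed.

Lemma inverse_transferM a b : T (f a ** b) = a ** T b.
Proof.
apply: inverse_transfer_eq.
  by rewrite cmulA P_central -cmulA PT.
by rewrite endoM fT !cmulA endo1l endo1r.
Qed.

Lemma inverse_transfer_corner y : e ** y = y -> y ** e = y -> f (T y) = y.
Proof. by move=> ey ye; rewrite fT ey ye. Qed.

(** If [e a e = y^2] with [y] in the corner, then [T a = (T y)^2]. *)
Lemma inverse_transfer_positive : cs_positive_map A T.
Proof.
move=> a /(compress_sqrt pe)[y [hy ey ye yy]]; apply/positiveP; exists (T y).
  exact: inverse_transfer_sa.
by apply: inverse_transfer_eq; rewrite ?cmulA ?PT // endoM inverse_transfer_corner.
Qed.

(** In the corner, [w = e a e] has a commuting selfadjoint partner [y] with [w^2 + y^2 = e]. Pulling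
    back gives [(T a)^2 + (T y)^2 = P], and [nrm_sum_sqr] bounds [|T a|^2] by [|P| <= 1]. *)
Lemma inverse_transfer_sa_le1 a : sa a -> nrm a <= 1 -> nrm (T a) <= 1.
Proof.
move=> ha a1; set w := e ** a ** e.
have ew : e ** w = w by rewrite /w !cmulA pe.1.
have we : w ** e = w by rewrite /w -!cmulA pe.1.
have hw : sa w := sa_compress pe ha.
have w1 : nrm w <= 1 := le_trans (nrm_compress _ pe) a1.
have [||y [hy ey ye yy cy]] := @compress_contraction _ _ A e (w ** w) pe.
- exact: sa_sqr.
- by rewrite nrm_sqr // exprn_ile1 // nrm_ge0.
have wwE : e ** (w ** w) ** e = w ** w by rewrite cmulA ew -cmulA we.
have wy : commute w y.
  by apply: cy; rewrite /ccommute ?wwE ?we ?ew // cmulA.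
have hTa := inverse_transfer_sa ha; have hTy := inverse_transfer_sa hy.
have PM b c : P ** (T b ** c) = T b ** c by rewrite cmulA PT.
have fTy := inverse_transfer_corner ey ye.
have cTy : commute (T a) (T y).
  by apply: f_inj; rewrite ?PM // !endoM fTy fT.
have := nrm_sum_sqr hTa hTy cTy.
have -> : T a ** T a + T y ** T y = P.
  apply: f_inj; rewrite ?cmulDr ?PM ?P_proj.1 //.
  by rewrite (cs_linearD endo_linear) !endoM fT fTy yy wwE fP subrKC.
have := nrm_projection P_proj; have := nrm_ge0 (T a); nra.
Qed.

Lemma inverse_transfer_contraction a : nrm (T a) <= nrm a.
Proof.
have contr_sa b : sa b -> nrm (T b) <= nrm b.
  move=> hb; have := nrm_ge0 b; rewrite le_eqVlt => /predU1P[n0|n0].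
    by rewrite -n0 (nrm0_eq0 (esym n0)) (cs_linear0 inverse_transfer_linear) nrm0.
  have := @inverse_transfer_sa_le1 ((nrm b)^-1%:C *: b) (saZ _ hb).
  rewrite (cs_linearZ inverse_transfer_linear) !nrmZ ger0_norm ?invr_ge0 ?(ltW n0) //.
  by rewrite mulVf ?gt_eqF // mulrC ler_pdivrMr // mul1r => ->.
set w := e ** a ** e.
(* The C*-identity reduces the general case to the selfadjoint element [star w ** w]. *)
have E : T (star w ** w) = star (T a) ** T a.
  apply: inverse_transfer_eq.
    by rewrite cmulA -inverse_transfer_star PT.
  rewrite endoM endo_star fT -/w /w !cstarM pe.2 !cmulA pe.1.
  by rewrite -!cmulA pe.1.
have := contr_sa (star w ** w); rewrite E !nrm_star_mul /cs_selfadjoint cstarM cstarK.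
move=> /(_ erefl); have := nrm_compress a pe; rewrite -/w.
have := nrm_ge0 (T a); have := nrm_ge0 a; have := nrm_ge0 w; nra.
Qed.

End InverseTransfer.
End Endomorphism.

End SingleEndomorphism.

(** * Transfer actions *)

Section Transfer.
Variables (R : realType) (V : completeNormedModType R[i]) (A : cstarAlgebra V).
Local Notation "a ** b" := (cmul A a b) (at level 40, left associativity).
Local Notation one := (cone A).
Variables (G : zmodType) (le : rel G) (alpha : G -> V -> V).
Hypotheses (le_group : total_ordered_group le)
  (alpha_action : endo_semigroup_action A le alpha).
Implicit Types (L : G -> V -> V) (P : G -> V) (x y : G).

Let alpha_endo x : le 0 x -> star_endomorphism A (alpha x).
Proof. by case: alpha_action => + _ _; apply. Qed.

Let alphaD x y a : le 0 x -> le 0 y -> alpha (x + y) a = alpha x (alpha y a).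
Proof. by case: alpha_action => _ _ h hx hy; rewrite -h. Qed.

Lemma le0_add x y : le 0 x -> le 0 y -> le 0 (x + y).
Proof.
case: le_group => _ _ trans _ mono hx hy; apply: (trans _ y) => //.
by have := mono _ _ y hx; rewrite add0r.
Qed.

Lemma nondegenerate_complete L :
  (forall x, le 0 x -> hereditary_subalgebra A (range_alpha alpha x)) ->
  nondegenerate_transfer_action A le alpha L -> complete_transfer_action A le alpha L.
Proof.
move=> her [[Lx LD LM] LE]; split=> // x a hx; have [lin _ pos] := Lx x hx.
apply: (hereditary_range_complete (alpha_endo hx) lin pos).
- by move=> b c; apply: LM.
- by case: (LE x hx).
- exact: her.
Qed.

Lemma complete_nondegenerate L : complete_transfer_action A le alpha L ->
  nondegenerate_transfer_action A le alpha L.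
Proof.
move=> [[Lx LD LM] LC]; split=> // x hx; have [lin _ pos] := Lx x hx.
by apply: (complete_expectation (alpha_endo hx) lin pos) => a; apply: LC.
Qed.

Lemma complete_action_hereditary L : complete_transfer_action A le alpha L ->
  forall x, le 0 x -> hereditary_subalgebra A (range_alpha alpha x).
Proof.
move=> [_ LC] x hx; apply: (complete_hereditary (alpha_endo hx)) => a; exact: LC.
Qed.

Lemma complete_range_is_corner L : complete_transfer_action A le alpha L ->
  range_is_corner A le alpha.
Proof.
by move=> [_ LC] x hx c; apply: (complete_range (alpha_endo hx)) => a; apply: LC.
Qed.

Lemma complete_projection_family L : complete_transfer_action A le alpha L ->
  projection_family A le alpha (fun x => L x one).
Proof.
move=> [[Lx LD LM] LC]; split.
- move=> x hx; have [lin _ pos] := Lx x hx.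
  have LMx a b := LM x a b hx; have LCx a := LC x a hx; split.
    exact: (complete_projection (alpha_endo hx)).
  exact: (transfer1_central (alpha_endo hx)).
(* The law composes as [L (x + y) = L y \o L x]; commuting the sum puts [L x] outermost, where
   [alpha x] turns it into a compression of the central element [L y 1]. *)
- move=> x y hx hy; rewrite addrC LD //= LC // -cmulA.
  have [lin _ pos] := Lx y hy.
  have LMy a b := LM y a b hy.
  rewrite (transfer1_central (alpha_endo hy) lin pos LMy).
  by rewrite cmulA (endo_projection (alpha_endo hx)).1.
- move=> x hx; have [lin _ pos] := Lx x hx.
  have LMx a b := LM x a b hx; have LCx a := LC x a hx.
  exact: (complete_bijective (alpha_endo hx)).
Qed.

Lemma corner_leftP p a : cs_projection A p -> corner_left A p a <-> p ** a = a.
Proof.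
move=> [pp _]; split=> [[b ->]|pa]; first by rewrite cmulA pp.
by exists a; rewrite pa.
Qed.

Section ProjectionFamily.
Variable P : G -> V.
Hypothesis P_family : projection_family A le alpha P.

Lemma family_projection x : le 0 x -> cs_projection A (P x).
Proof. by case: P_family => + _ _ hx => /(_ x hx)[]. Qed.

Lemma family_central x : le 0 x -> cs_central A (P x).
Proof. by case: P_family => + _ _ hx => /(_ x hx)[]. Qed.

Lemma family_inj x a b : le 0 x ->
  P x ** a = a -> P x ** b = b -> alpha x a = alpha x b -> a = b.
Proof.
move=> hx Pa Pb; case: P_family => _ _ /(_ x hx)[_ inj _].
by apply: inj; apply/(corner_leftP _ (family_projection hx)).
Qed.

Lemma le00 : le 0 0. Proof. by case: le_group. Qed.

(** As [alpha 0] is the identity, condition (b) puts the unit into the corner of [P 0]. *)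
Lemma family0 : P 0 = one.
Proof.
have alpha0 : alpha 0 = id by case: alpha_action.
case: P_family => _ _ /(_ 0 le00)[_ _ /(_ one)].
case=> [|a /(corner_leftP _ (family_projection le00)) + a1].
  by exists one; rewrite alpha0.
by move: a1; rewrite alpha0 /= => ->; rewrite cmul1r.
Qed.

Lemma family_alpha x : le 0 x -> alpha x (P x) = alpha x one.
Proof.
move=> hx; case: P_family => _ PD _.
by have := PD x 0 hx le00; rewrite addr0 family0 cmul1r.
Qed.

(** [L x a] is the preimage of [alpha x 1 a alpha x 1] in the corner of [P x], which exists because
    the range is the whole corner. *)
Lemma family_complete : range_is_corner A le alpha ->
  exists L, complete_transfer_action A le alpha L.
Proof.
move=> corner.
have /choice[/= T TE] : forall xa : G * V, exists c, le 0 xa.1 ->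
    P xa.1 ** c = c /\
    alpha xa.1 c = alpha xa.1 one ** xa.2 ** alpha xa.1 one.
  (* Outside the positive cone the requirement is vacuous and 0 is a placeholder. *)
  move=> [x a] /=; case: (boolP (le 0 x)) => [hx|_]; last by exists 0.
  case: P_family => _ _ /(_ x hx)[_ _ surj].
  have [|c /(corner_leftP _ (family_projection hx)) Pc fc] :=
    surj (alpha x one ** a ** alpha x one).
    by apply/(corner x hx); exists a.
  by exists c => _.
pose L x a := T (x, a).
have LE x : le 0 x -> forall a, P x ** L x a = L x a /\
    alpha x (L x a) = alpha x one ** a ** alpha x one.
  by move=> hx a; apply: (TE (x, a)).
have inj x hx a b := @family_inj x a b hx.
exists L; split; last by move=> x a hx; case: (LE x hx a).
split.
- move=> x hx; have lin := inverse_transfer_linear (alpha_endo hx) (inj x hx) (LE x hx).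
  split=> //; last first.
    apply: (inverse_transfer_positive (alpha_endo hx) _ _ (inj x hx) (LE x hx)).
      exact: family_projection.
    exact: family_central.
  apply: contraction_continuous => // a.
  apply: (inverse_transfer_contraction (alpha_endo hx) _ _ (inj x hx) _ (LE x hx)).
  + exact: family_projection.
  + exact: family_central.
  + exact: family_alpha.
- move=> x y hx hy; apply/funext => a /=; have hxy := le0_add hx hy.
  apply: (inverse_transfer_eq (inj _ hxy) (LE _ hxy)).
    (* To see that [L y (L x a)] lies in the corner of [P (x + y)], apply [alpha y]: condition (a)
       sends [P (x + y)] to [alpha y 1 P x], and [P x] is absorbed by [L x a]. *)
    apply: (inj y hy).
    + rewrite cmulA (family_central hy) -cmulA.
      by rewrite (LE y hy (L x a)).1.
    + exact: (LE y hy _).1.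
    rewrite (endoM (alpha_endo hy)) addrC.
    case: P_family => _ -> // _.
    rewrite -(family_central hx) -cmulA (endo1l (alpha_endo hy)).
    rewrite (LE y hy _).2 !cmulA (family_central hx) -(cmulA A _ (P x)).
    by rewrite (LE x hx a).1.
  (* The image is the compression of [a] first by [alpha x 1], then by its subprojection
     [alpha x (alpha y 1)], which is [alpha (x + y) 1]. *)
  rewrite !alphaD // (LE y hy _).2 !(endoM (alpha_endo hx)) (LE x hx _).2.
  by rewrite !cmulA (endo1r (alpha_endo hx)) -!cmulA (endo1l (alpha_endo hx)).
- move=> x a b hx.
  apply: (inverse_transferM (alpha_endo hx) _ (inj x hx) (LE x hx)).
  exact: family_central.
Qed.

End ProjectionFamily.

(** [P x Q x] and [P x] both lie in the corner of [P x] and have image [alpha x 1], so they agree;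
    by symmetry and centrality the two projections coincide. *)
Lemma family_unique P1 P2 : projection_family A le alpha P1 ->
  projection_family A le alpha P2 -> forall x, le 0 x -> P1 x = P2 x.
Proof.
move=> fam1 fam2 x hx.
have absorb P Q : projection_family A le alpha P -> projection_family A le alpha Q ->
    P x ** Q x = P x.
  move=> famP famQ; have [PP _] := family_projection famP hx.
  apply: (family_inj famP hx); rewrite ?cmulA ?PP //.
  rewrite (endoM (alpha_endo hx)) (family_alpha famP hx) (family_alpha famQ hx).
  exact: endo1l (alpha_endo hx) one.
by rewrite -(absorb _ _ fam1 fam2) (family_central fam1 hx) absorb.
Qed.

Lemma complete_action_unique L1 L2 : complete_transfer_action A le alpha L1 ->
  complete_transfer_action A le alpha L2 -> forall x, le 0 x -> L1 x = L2 x.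
Proof.
move=> [[L1x _ L1M] L1C] [[_ _ L2M] L2C] x hx; have [lin _ pos] := L1x x hx.
have L1Mx a b := L1M x a b hx; have L1Cx a := L1C x a hx.
have L2Mx a b := L2M x a b hx; have L2Cx a := L2C x a hx.
exact: (complete_unique (alpha_endo hx)).
Qed.

End Transfer.

Theorem theorem2p4 (R : realType) (V : completeNormedModType R[i]) (A : cstarAlgebra V)
  (G : zmodType) (le : rel G) (alpha : G -> V -> V) :
  total_ordered_group le ->
  endo_semigroup_action A le alpha ->
  (* 1) <-> 2) *)
  ((exists L, complete_transfer_action A le alpha L) <->
   ((exists L, nondegenerate_transfer_action A le alpha L) /\
    (forall x, le 0 x -> hereditary_subalgebra A (range_alpha alpha x)))) /\
  (* 2) <-> 3) *)
  (((exists L, nondegenerate_transfer_action A le alpha L) /\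
    (forall x, le 0 x -> hereditary_subalgebra A (range_alpha alpha x))) <->
   ((exists P, projection_family A le alpha P) /\ range_is_corner A le alpha)) /\
  (* uniqueness of L in 1) *)
  (forall L1 L2, complete_transfer_action A le alpha L1 ->
     complete_transfer_action A le alpha L2 -> forall x, le 0 x -> L1 x = L2 x) /\
  (* uniqueness of L in 2), and it is the L of 1) *)
  ((forall x, le 0 x -> hereditary_subalgebra A (range_alpha alpha x)) ->
     (forall L, nondegenerate_transfer_action A le alpha L ->
        complete_transfer_action A le alpha L) /\
     (forall L1 L2, nondegenerate_transfer_action A le alpha L1 ->
        nondegenerate_transfer_action A le alpha L2 ->
        forall x, le 0 x -> L1 x = L2 x)) /\
  (* uniqueness of {P_x} in 3) *)
  (range_is_corner A le alpha ->
     forall P1 P2, projection_family A le alpha P1 -> projection_family A le alpha P2 ->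
       forall x, le 0 x -> P1 x = P2 x) /\
  (* relations: P_x = L_x(1) and L_x(a) = alpha_x^{-1}(alpha_x(1) a alpha_x(1)) *)
  (forall L P, complete_transfer_action A le alpha L ->
     projection_family A le alpha P -> range_is_corner A le alpha ->
     forall x, le 0 x ->
       P x = L x (cone A) /\
       (forall a, corner_left A (P x) (L x a) /\
                  alpha x (L x a) = cmul A (cmul A (alpha x (cone A)) a) (alpha x (cone A)))).
Proof.
move=> grp act.
(* Shared by two implications, since 3) reaches 2) through 1). *)
have C_ND L : complete_transfer_action A le alpha L ->
    (exists L, nondegenerate_transfer_action A le alpha L) /\
    (forall x, le 0 x -> hereditary_subalgebra A (range_alpha alpha x)).
  move=> cL; split; last exact: (complete_action_hereditary act cL).
  by exists L; apply: (complete_nondegenerate act cL).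
split; [|split; [|split; [|split; [|split]]]].
- split=> [[L /C_ND//]|[[L ndL] her]].
  by exists L; apply: nondegenerate_complete.
- split=> [[[L ndL] her]|[[P famP] corner]].
    have cL := nondegenerate_complete act her ndL; split.
      by exists (fun x => L x (cone A)); apply: complete_projection_family.
    exact: (complete_range_is_corner act cL).
  by have [L /C_ND] := family_complete grp act famP corner.
- by move=> L1 L2; apply: (complete_action_unique act).
- move=> her; split=> [L|L1 L2 /(nondegenerate_complete act her) c1
    /(nondegenerate_complete act her) c2]; first exact: nondegenerate_complete.
  exact: (complete_action_unique act c1 c2).
- by move=> _ P1 P2; apply: (family_unique grp act).
- move=> L P cL famP _ x hx.
  (* The values [L x 1] form a projection family, so uniqueness of such families identifies them
     with [P x]. *)
  have PE : P x = L x (cone A).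
    exact: (family_unique grp act famP (complete_projection_family act cL)).
  split=> // a; case: cL => [[_ _ LM] LC]; split; last exact: LC.
  rewrite PE; exists (L x a); apply/esym.
  have endo : star_endomorphism A (alpha x) by case: act => + _ _; apply.
  have LMx a b := LM x a b hx; have LCx b := LC x b hx.
  exact: (complete_corner endo).
Qed.
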